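(* Assume that (H1)-(H2) hold, $\widetilde{\mathcal{L}}$ is compact and $k_{w}(x, \cdot) \in L^2(pw)$ for some $x\in ]a,b[$. For all $g_0\in E^2(p,w)$ such that $\mathbb{E}_p[g_0 e_1w]\neq 0$, we have $$\lim_{n\rightarrow \infty}\left(\frac{\widetilde{\mathcal{L}} ^{n+1}g_0}{\widetilde{\mathcal{L}} ^ng_0}\right)(x)=C(p,w).$$
   Context: Let $-\infty\le a<b\le\infty$, $p$ a probability density on $]a,b[$ with $p>0$ a.e., $w\in L^1_{\text{loc}}(]a,b[)$ a weight with $w>0$ a.e. and $pw\in L^1_{\text{loc}}$. Let $P(x)=\int_a^x p$, $\bar P=1-P$, $K(x,y)=P(x\wedge y)\bar P(x\vee y)$, $k(x,y)=K(x,y)/(p(x)p(y))$, $k_w(x,y)=k(x,y)/(w(x)w(y))$. $C(p,w)$ is the smallest $C$ with $\mathrm{Var}_p[h]\le C\,\mathbb{E}_p[|h'|^2w]$ for all weakly differentiable $h\in L^2(p)$ with $h'\in L^2(pw)$. Hypotheses: (H1) $C(p,w)<\infty$; (H2) $L^2(pw)\subset L^1_{\text{loc}}(]a,b[)$. $E^2(p,w)=\{f\in L^2(pw)\cap L^1_{\text{loc}}: x\mapsto\int_{x_0}^x f\in L^2(p)\}$ with $L^2(pw)$ norm. The operator $\widetilde{\mathcal{L}} f(x)=\frac{1}{p(x)w(x)}\int_a^b K(x,y)f(y)\,dy$, iterates $\widetilde{\mathcal{L}}^{n+1}=\widetilde{\mathcal{L}}(\widetilde{\mathcal{L}}^n)$;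 pointwise values at $x$ are understood via $\int_a^bK(x,\cdot)f$, which makes sense when $k_w(x,\cdot)\in L^2(pw)$. When compact, $\widetilde{\mathcal{L}}$ has largest eigenvalue $\kappa_1=C(p,w)$ with a.e. positive eigenvector $e_1$ (part of an orthonormal eigenbasis of $E^2(p,w)$). *)

(* Defs.v *)
From HB Require Import structures.
From mathcomp Require Import all_boot all_order all_algebra.
From mathcomp Require Import all_classical all_reals all_analysis.
Set Implicit Arguments. Unset Strict Implicit. Unset Printing Implicit Defensive.
Import Order.TTheory GRing.Theory Num.Theory.
Import numFieldNormedType.Exports.
Local Open Scope classical_set_scope.
Local Open Scope ring_scope.

Section Defs.
Variable R : realType.
Notation leb := (@lebesgue_measure R).

Definition Iab (a b : \bar R) : set R := [set x | (a < x%:E)%E /\ (x%:E < b)%E].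

Definition intI (a b : \bar R) (f : R -> R) : \bar R :=
  (\int[leb]_(x in Iab a b) (f x)%:E)%E.

Definition L1loc (a b : \bar R) (f : R -> R) : Prop :=
  forall c d : R, (a < c%:E)%E -> (d%:E < b)%E ->
    leb.-integrable `[c, d] (EFin \o f).

Definition L2w (a b : \bar R) (m f : R -> R) : Prop :=
  measurable_fun (Iab a b) f /\ (intI a b (fun x => (f x ^+ 2 * m x)%R) < +oo)%E.

Definition is_density (a b : \bar R) (p : R -> R) : Prop :=
  [/\ measurable_fun (Iab a b) p,
      intI a b p = 1%E &
      {ae leb, forall x, Iab a b x -> 0 < p x}].

Definition is_weight (a b : \bar R) (p w : R -> R) : Prop :=
  [/\ L1loc a b w,
      {ae leb, forall x, Iab a b x -> 0 < w x} &
      L1loc a b (fun x => p x * w x)].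

Definition Pcdf (a b : \bar R) (p : R -> R) (x : R) : R :=
  fine (\int[leb]_(y in [set y | Iab a b y /\ (y <= x)%R]) (p y)%:E)%E.

Definition Kker (a b : \bar R) (p : R -> R) (x y : R) : R :=
  Pcdf a b p (Num.min x y) * (1 - Pcdf a b p (Num.max x y)).

Definition kw (a b : \bar R) (p w : R -> R) (x y : R) : R :=
  Kker a b p x y / (p x * p y * w x * w y).

Definition test_fun (a b : \bar R) (phi : R -> R) : Prop :=
  [/\ forall x, derivable phi x 1,
      continuous (derive1 phi) &
      exists c d : R, [/\ (a < c%:E)%E, (d%:E < b)%E &
        forall x, ~ (c <= x <= d) -> phi x = 0]].

Definition weak_deriv (a b : \bar R) (h g : R -> R) : Prop :=
  [/\ L1loc a b h, L1loc a b g &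
      forall phi, test_fun a b phi ->
        intI a b (fun x => h x * derive1 phi x) = (- intI a b (fun x => (g x * phi x)%R))%E].

Definition Var_p (a b : \bar R) (p h : R -> R) : R :=
  fine (intI a b (fun x => h x ^+ 2 * p x)) - (fine (intI a b (fun x => h x * p x))) ^+ 2.

Definition energy (a b : \bar R) (p w g : R -> R) : R :=
  fine (intI a b (fun x => g x ^+ 2 * w x * p x)).

Definition poincare_consts (a b : \bar R) (p w : R -> R) : set R :=
  [set C | 0 <= C /\
    forall h g : R -> R, L2w a b p h -> weak_deriv a b h g ->
      L2w a b (fun x => p x * w x) g ->
      Var_p a b p h <= C * energy a b p w g].

(* C(p,w): the smallest such constant (+oo if none) *)
Definition Cpw (a b : \bar R) (p w : R -> R) : \bar R :=
  ereal_inf (EFin @` poincare_consts a b p w).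

Definition H1 (a b : \bar R) (p w : R -> R) : Prop := (Cpw a b p w < +oo)%E.

Definition H2 (a b : \bar R) (p w : R -> R) : Prop :=
  forall f, L2w a b (fun x => p x * w x) f -> L1loc a b f.

Definition prim (x0 : R) (f : R -> R) (x : R) : R :=
  if x0 <= x then fine (\int[leb]_(y in `[x0, x]) (f y)%:E)%E
  else - fine (\int[leb]_(y in `[x, x0]) (f y)%:E)%E.

Definition E2 (a b : \bar R) (p w f : R -> R) : Prop :=
  [/\ L2w a b (fun x => p x * w x) f, L1loc a b f &
      exists2 x0, Iab a b x0 & L2w a b p (prim x0 f)].

Definition normE2 (a b : \bar R) (p w f : R -> R) : R :=
  Num.sqrt (fine (intI a b (fun x => f x ^+ 2 * (p x * w x)))).

Definition Lt (a b : \bar R) (p w f : R -> R) (x : R) : R :=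
  fine (intI a b (fun y => Kker a b p x y * f y)) / (p x * w x).

Definition Lt_iter (a b : \bar R) (p w : R -> R) (n : nat) (f : R -> R) : R -> R :=
  iter n (Lt a b p w) f.

(* pointwise value at x, understood via int K(x,.) f (the factor 1/(p(x)w(x))
   common to numerator and denominator is dropped) *)
Definition Kval (a b : \bar R) (p : R -> R) (x : R) (f : R -> R) : R :=
  fine (intI a b (fun y => Kker a b p x y * f y)).

Definition Lt_compact (a b : \bar R) (p w : R -> R) : Prop :=
  (forall f, E2 a b p w f -> E2 a b p w (Lt a b p w f)) /\
  forall u : nat -> R -> R, (forall n, E2 a b p w (u n)) ->
    (exists M, forall n, normE2 a b p w (u n) <= M) ->
    exists (phi : nat -> nat) (f : R -> R),
      [/\ {homo phi : m n / (m < n)%N >-> (m < n)%N}, E2 a b p w f &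
          (fun n => normE2 a b p w (Lt a b p w (u (phi n)) \- f)) @ \oo --> (0 : R)].

Definition pos_eigvec (a b : \bar R) (p w : R -> R) (kappa : R) (e : R -> R) : Prop :=
  [/\ E2 a b p w e, normE2 a b p w e = 1,
      {ae leb, forall y, Iab a b y -> Lt a b p w e y = kappa * e y} &
      {ae leb, forall y, Iab a b y -> 0 < e y}].

End Defs.

(* Main.v *)
Require Import Defs.
From HB Require Import structures.
From mathcomp Require Import all_boot all_order all_algebra.
From mathcomp Require Import all_classical all_reals all_analysis measurable_realfun.
From mathcomp Require Import ring lra.
Set Implicit Arguments. Unset Strict Implicit. Unset Printing Implicit Defensive.
Import Order.TTheory GRing.Theory Num.Theory.
Import numFieldNormedType.Exports.
Local Open Scope classical_set_scope.
Local Open Scope ring_scope.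

(** Write [m = p w] and let [e] be the positive eigenvector, [int K(y,z) e(z) dz =
    kappa e(y) m(y)].  Since [K] is symmetric and positive, Tonelli gives the
    Schur-test identity
    [int int K(x,y) e(x) e(y) (f(y)/e(y) - g(x)/e(x))^2 dy dx
       = kappa |f|^2 - 2 <L f, g> + kappa |g|^2]  in [L^2(m)].
    It shows that [L / kappa] is a contraction, that [<L f, e> = kappa <f, e>],
    and that [|L f| = kappa |f|] forces [f] to be a multiple of [e].  Hence, with
    [c = <g0, e>], the norms of [v_n = kappa^-n L^n g0 - c e] decrease; by
    compactness their limit is the norm of a multiple of some [G] orthogonal to
    [e] with [|L G| = kappa |G|], so it is [0].  As [K(x,.)/m] is in [L^2(m)], the
    value at [x] of [kappa^-n L^n g0] tends to [c int K(x,z) e(z) dz <> 0], and the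
    ratio of consecutive iterates tends to [kappa]. *)

(** * Semi-inner product and Cauchy-Schwarz in a weighted $L^2$ space *)

Section WeightedL2.
Context d (T : measurableType d) (R : realType) (mu : {measure set T -> \bar R}).
Variables (D : set T) (m : T -> R).
Hypothesis mD : measurable D.
Hypothesis mm : measurable_fun D m.
Hypothesis m_gt0 : forall x, D x -> 0 < m x.

(** Elements are genuine functions, not classes modulo null sets, so [ip] below is only a semi-inner
    product and [ip f f = 0] plays the role of $f = 0$. *)
Definition L2 (f : T -> R) : Prop :=
  measurable_fun D f /\ mu.-integrable D (EFin \o (fun x => f x ^+ 2 * m x)).

Definition ip (f g : T -> R) : R := \int[mu]_(x in D) (f x * g x * m x).

Lemma integrable_le (f g : T -> R) : measurable_fun D f ->
  mu.-integrable D (EFin \o g) -> (forall x, D x -> `|f x| <= g x) ->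
  mu.-integrable D (EFin \o f).
Proof.
move=> mf ig fg; apply: (le_integrable mD _ _ ig); first exact/measurable_EFinP.
by move=> x Dx /=; rewrite lee_fin (le_trans (fg x Dx))// ler_norm.
Qed.

Lemma integrable_lin (k : R) (f g : T -> R) : mu.-integrable D (EFin \o f) ->
  mu.-integrable D (EFin \o g) ->
  mu.-integrable D (EFin \o (fun x => k * f x + g x)).
Proof.
move=> fi gi; have := integrableD mD (integrableZl mD k fi) gi.
by apply: eq_integrable => // x _ /=; rewrite EFinD EFinM.
Qed.

Lemma Rintegral_lin (k : R) (f g : T -> R) : mu.-integrable D (EFin \o f) ->
  mu.-integrable D (EFin \o g) ->
  \int[mu]_(x in D) (k * f x + g x) =
  k * \int[mu]_(x in D) f x + \int[mu]_(x in D) g x.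
Proof.
move=> fi gi; rewrite RintegralD ?RintegralZl//.
have := integrableZl mD k fi.
by apply: eq_integrable => // x _ /=; rewrite EFinM.
Qed.

Lemma integrable_L2M (f g : T -> R) : L2 f -> L2 g ->
  mu.-integrable D (EFin \o (fun x => f x * g x * m x)).
Proof.
move=> [mf fi] [mg gi].
(* Domination by $|fg| \le f^2 + g^2$; the factor 1 only gives the bound the shape of
   [integrable_lin]. *)
apply: (@integrable_le _ (fun x => 1 * (f x ^+ 2 * m x) + g x ^+ 2 * m x)).
- by apply: measurable_funM => //; exact: measurable_funM.
- exact: integrable_lin.
- move=> x Dx; have mx := m_gt0 Dx.
  rewrite normrM (gtr0_norm mx) mul1r -mulrDl ler_pM2r// ler_norml.
  by apply/andP; split; nra.
Qed.

Lemma L2_lin (k : R) (f g : T -> R) : L2 f -> L2 g ->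
  L2 (fun x => k * f x + g x).
Proof.
move=> Lf Lg; have fgi := integrable_L2M Lf Lg.
case: Lf Lg => mf fi [mg gi]; split.
  apply: measurable_funD => //; exact: measurable_funM.
have := integrable_lin (k ^+ 2) fi (integrable_lin (2 * k) fgi gi).
by apply: eq_integrable => // x _ /=; congr EFin; ring.
Qed.

Lemma L2Z (k : R) (f : T -> R) : L2 f -> L2 (fun x => k * f x).
Proof.
(* Uses $kf = (k-1)f + f$. *)
move=> Lf; have := L2_lin (k - 1) Lf Lf.
by congr L2; apply/funext => x; ring.
Qed.

Lemma eq_ip (f f' g g' : T -> R) : (forall x, D x -> f x = f' x) ->
  (forall x, D x -> g x = g' x) -> ip f g = ip f' g'.
Proof.
by move=> ff gg; apply: eq_Rintegral => x /set_mem Dx; rewrite ff// gg.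
Qed.

Lemma ipC (f g : T -> R) : ip f g = ip g f.
Proof. by apply: eq_Rintegral => x _; rewrite (mulrC (f x)). Qed.

Lemma ip_linl (k : R) (f g h : T -> R) : L2 f -> L2 g -> L2 h ->
  ip (fun x => k * f x + g x) h = k * ip f h + ip g h.
Proof.
move=> Lf Lg Lh.
rewrite /ip -Rintegral_lin; [|exact: integrable_L2M..].
by apply: eq_Rintegral => x _; ring.
Qed.

Lemma ip_linr (k : R) (f g h : T -> R) : L2 f -> L2 g -> L2 h ->
  ip h (fun x => k * f x + g x) = k * ip h f + ip h g.
Proof. by move=> *; rewrite ipC ip_linl// !(ipC h). Qed.

Lemma ipZl (k : R) (f h : T -> R) : L2 f -> L2 h ->
  ip (fun x => k * f x) h = k * ip f h.
Proof.
move=> Lf Lh; rewrite /ip -RintegralZl//; last exact: integrable_L2M.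
by apply: eq_Rintegral => x _; ring.
Qed.

Lemma ip_ge0 (f : T -> R) : 0 <= ip f f.
Proof.
by apply: Rintegral_ge0 => x /m_gt0/ltW; apply: mulr_ge0; rewrite -expr2 sqr_ge0.
Qed.

Lemma ip_sqr_lin (k : R) (f g : T -> R) : L2 f -> L2 g ->
  ip (fun x => k * f x + g x) (fun x => k * f x + g x) =
  k ^+ 2 * ip f f + 2 * k * ip f g + ip g g.
Proof.
move=> Lf Lg; have Lfg := L2_lin k Lf Lg.
rewrite ip_linl// !ip_linr// (ipC g f); ring.
Qed.

Lemma ip_cauchy_schwarz (f g : T -> R) : L2 f -> L2 g ->
  ip f g ^+ 2 <= ip f f * ip g g.
Proof.
move=> Lf Lg.
have q (k : R) : 0 <= k ^+ 2 * ip f f + 2 * k * ip f g + ip g g.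
  by rewrite -ip_sqr_lin// ip_ge0.
have [f0|f0] := eqVneq (ip f f) 0.
  have [->|fg0] := eqVneq (ip f g) 0; first by rewrite f0 mul0r expr0n.
  (* With [ip f f = 0] the polynomial [q] is affine in [k]; at this [k] it would equal $-1$. *)
  have := q (- (ip g g + 1) / (2 * ip f g)).
  rewrite f0 mulr0 add0r (_ : 2 * _ * _ = - (ip g g + 1)); first by lra.
  by field.
have fp : 0 < ip f f by rewrite lt_def f0 ip_ge0.
(* The minimiser of the quadratic polynomial. *)
have := q (- ip f g / ip f f).
rewrite (_ : _ + _ = (ip f f * ip g g - ip f g ^+ 2) / ip f f); last by field.
by rewrite pmulr_lge0 ?invr_gt0// subr_ge0.
Qed.

Lemma cvg_ip0 (s : nat -> T -> R) (h : T -> R) : (forall n, L2 (s n)) -> L2 h ->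
  (fun n => ip (s n) (s n)) @ \oo --> (0 : R) ->
  (fun n => ip (s n) h) @ \oo --> (0 : R).
Proof.
move=> Ls Lh s0; apply/norm_cvg0P.
have ub : (fun n => Num.sqrt (ip (s n) (s n) * ip h h)) @ \oo --> (0 : R).
  rewrite -[X in _ --> X]sqrtr0 -(mul0r (ip h h)).
  apply: (continuous_cvg _ (@sqrt_continuous R (0 * ip h h))).
  by apply: cvgM => //; exact: cvg_cst.
refine (squeeze_cvgr _ (cvg_cst (0 : R)) ub).
near=> n; rewrite normr_ge0/= -sqrtr_sqr ler_wsqrtr//.
exact: ip_cauchy_schwarz.
Unshelve. all: by end_near. Qed.

(** In $|s_n|^2 = |s_n - g|^2 + 2\langle s_n - g, g\rangle + |g|^2$ the first term tends to 0 by
    hypothesis and the second by [cvg_ip0]. *)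
Lemma cvg_ip_sqr (s : nat -> T -> R) (g : T -> R) : (forall n, L2 (s n)) -> L2 g ->
  (fun n => ip (fun x => s n x - g x) (fun x => s n x - g x)) @ \oo --> (0 : R) ->
  (fun n => ip (s n) (s n)) @ \oo --> ip g g.
Proof.
move=> Ls Lg.
have Lsg n : L2 (fun x => s n x - g x).
  have := L2_lin (-1) Lg (Ls n).
  by congr L2; apply/funext => x; rewrite mulN1r addrC.
move=> sg0; have sgg := cvg_ip0 Lsg Lg sg0.
have -> : (fun n => ip (s n) (s n)) = (fun n =>
    ip (fun x => s n x - g x) (fun x => s n x - g x) +
    2 * ip (fun x => s n x - g x) g + ip g g).
  apply/funext => n.
  have := ip_sqr_lin 1 (Lsg n) Lg; rewrite expr1n mul1r mulr1 => <-.
  by apply: eq_ip => x _; rewrite mul1r subrK.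
rewrite -[X in _ --> X]add0r -[X in _ --> X + _](addr0 0).
apply: cvgD (cvg_cst _); apply: cvgD => //.
by rewrite -[X in _ --> X](mulr0 2); apply: cvgM => //; exact: cvg_cst.
Qed.

End WeightedL2.

(** * Tonelli's theorem on a rectangle of measurable sets *)

Section TonelliOn.
Local Open Scope ereal_scope.
Context d1 d2 (T1 : measurableType d1) (T2 : measurableType d2) (R : realType).
Variables (m1 : {sigma_finite_measure set T1 -> \bar R}).
Variables (m2 : {sigma_finite_measure set T2 -> \bar R}).
Variables (D1 : set T1) (D2 : set T2) (F : T1 * T2 -> \bar R).
Hypotheses (mD1 : measurable D1) (mD2 : measurable D2).
Hypothesis mF : measurable_fun (D1 `*` D2) F.
Hypothesis F0 : forall z, (D1 `*` D2) z -> 0 <= F z.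

(** Extending [F] by zero off the rectangle reduces everything to integrals over the whole spaces;
    the two restriction identities below translate back. *)
Let mFr : measurable_fun setT (F \_ (D1 `*` D2)).
Proof. exact: (measurable_restrictT F (measurableX mD1 mD2)).1 mF. Qed.

Let Fr0 z : 0 <= (F \_ (D1 `*` D2)) z.
Proof. exact: erestrict_ge0. Qed.

Let integral_restrict2 x : \int[m2]_y (F \_ (D1 `*` D2)) (x, y) =
  ((fun x => \int[m2]_(y in D2) F (x, y)) \_ D1) x.
Proof.
rewrite patchE; case: ifPn => xD1.
  rewrite [RHS]integral_mkcond; apply: eq_integral => y _; rewrite !patchE.
  by rewrite in_setX /= xD1.
by apply: integral0_eq => y _; rewrite patchE in_setX /= (negbTE xD1).
Qed.

Let integral_restrict1 y : \int[m1]_x (F \_ (D1 `*` D2)) (x, y) =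
  ((fun y => \int[m1]_(x in D1) F (x, y)) \_ D2) y.
Proof.
rewrite patchE; case: ifPn => yD2.
  rewrite [RHS]integral_mkcond; apply: eq_integral => x _; rewrite !patchE.
  by rewrite in_setX /= yD2 andbT.
by apply: integral0_eq => x _; rewrite patchE in_setX /= (negbTE yD2) andbF.
Qed.

Lemma measurable_fun_integral_in :
  measurable_fun D1 (fun x => \int[m2]_(y in D2) F (x, y)).
Proof.
apply/(measurable_restrictT _ mD1).2; rewrite -(funext integral_restrict2).
exact: measurable_fun_fubini_tonelli_F.
Qed.

Lemma tonelli_in : \int[m1]_(x in D1) \int[m2]_(y in D2) F (x, y) =
  \int[m2]_(y in D2) \int[m1]_(x in D1) F (x, y).
Proof.
rewrite integral_mkcond [RHS]integral_mkcond -(funext integral_restrict2).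
by rewrite -(funext integral_restrict1); exact: fubini_tonelli.
Qed.

End TonelliOn.

(** * Integrals of positive functions and almost everywhere statements *)

Section PositiveIntegral.
Context d (T : measurableType d) (R : realType) (mu : {measure set T -> \bar R}).
Variables (D : set T) (mD : measurable D).

(** Otherwise [D] would lie inside the exceptional null set. This is how an almost everywhere
    statement yields an actual point. *)
Lemma ae_in_nonnull (P : T -> Prop) : mu D != 0%E ->
  {ae mu, forall x, D x -> P x} -> exists2 x, D x & P x.
Proof.
move=> D0 [N [mN N0 PN]]; apply: contrapT => nP.
suff : mu D = 0%E by apply/eqP.
apply: (subset_measure0 mD mN) => // x Dx; apply: PN => /= /(_ Dx) Px.
by apply: nP; exists x.
Qed.

Lemma integral_eq0_ae (f : T -> \bar R) : measurable_fun D f ->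
  (forall x, D x -> 0 <= f x)%E -> (\int[mu]_(x in D) f x = 0)%E ->
  {ae mu, forall x, D x -> f x = 0%E}.
Proof.
move=> mf f0 If; apply: (ae_eq_integral_abs mu mD mf).1.
by rewrite -[RHS]If; apply: eq_integral => x /set_mem/f0/gee0_abs.
Qed.

Lemma Rintegral_gt0 (f : T -> R) : mu D != 0%E ->
  mu.-integrable D (EFin \o f) -> (forall x, D x -> 0 < f x) ->
  0 < \int[mu]_(x in D) f x.
Proof.
move=> D0 fi f0; rewrite lt_def Rintegral_ge0 ?andbT; last by move=> x /f0/ltW.
apply/eqP => If.
have /(ae_in_nonnull D0)[x /f0 + []] : {ae mu, forall x, D x -> (f x)%:E = 0%E}.
  apply: integral_eq0_ae; first exact: measurable_int fi.
    by move=> x /f0/ltW; rewrite lee_fin.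
  by rewrite -[LHS]fineK ?integrable_fin_num// -/(Rintegral _ _ _) If.
by move=> /lt0r_neq0/eqP.
Qed.

Lemma measurable_fun_inv_gt0 (f : T -> R) : (forall x, D x -> 0 < f x) ->
  measurable_fun D f -> measurable_fun D (fun x => (f x)^-1).
Proof.
(* On positive values inversion is the real power $-1$, which is measurable on the whole line. *)
move=> f0 mf; apply: (eq_measurable_fun (fun x => f x `^ (-1))).
  by move=> x /set_mem/f0/ltW fx; rewrite powR_inv1.
by apply: (measurableT_comp (f := @powR R ^~ (-1))) mf; exact: measurable_powR.
Qed.

End PositiveIntegral.

(** * The Schur-test identity and its consequences *)

Section SchurEnergy.
Context d (T : measurableType d) (R : realType).
Variable mu : {sigma_finite_measure set T -> \bar R}.
Variables (D : set T) (m e : T -> R) (K : T -> T -> R) (kappa : R).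
Hypothesis mD : measurable D.
Hypothesis mm : measurable_fun D m.
Hypothesis m_gt0 : forall x, D x -> 0 < m x.
Hypothesis mK : measurable_fun (D `*` D) (fun z : T * T => K z.1 z.2).
Hypothesis K_gt0 : forall x y, D x -> D y -> 0 < K x y.
Hypothesis K_sym : forall x y, D x -> D y -> K x y = K y x.
Hypothesis K_int : forall f y, L2 mu D m f -> D y ->
  mu.-integrable D (EFin \o (fun z => K y z * f z)).
Hypothesis e_L2 : L2 mu D m e.
Hypothesis e_gt0 : forall x, D x -> 0 < e x.
Hypothesis e_norm : ip mu D m e e = 1.
Hypothesis e_eigen : forall y, D y ->
  \int[mu]_(z in D) (K y z * e z) = kappa * (e y * m y).

Local Notation L2 := (L2 mu D m).
Local Notation ip := (ip mu D m).

(** The graph of the operator with kernel $K(y,z)/m(y)$, free of division. Being a relation, it also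
    applies to combinations such as $f - ce$ that are tracked only in $L^2(m)$. *)
Definition kernel_image (f h : T -> R) : Prop :=
  forall y, D y -> h y * m y = \int[mu]_(z in D) (K y z * f z).

Lemma kernel_image_lin (k : R) (f h f' h' : T -> R) : L2 f -> L2 f' ->
  kernel_image f h -> kernel_image f' h' ->
  kernel_image (fun x => k * f x + f' x) (fun x => k * h x + h' x).
Proof.
move=> Lf Lf' fh fh' y Dy; rewrite mulrDl -mulrA fh// fh'//.
rewrite -Rintegral_lin; [|exact: mD|exact: K_int..].
by apply: eq_Rintegral => z _; ring.
Qed.

Lemma kernel_imageZ (k : R) (f h : T -> R) : L2 f -> kernel_image f h ->
  kernel_image (fun x => k * f x) (fun x => k * h x).
Proof.
move=> Lf fh y Dy; rewrite -mulrA fh// -RintegralZl//; last exact: K_int.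
by apply: eq_Rintegral => z _; ring.
Qed.

Lemma kernel_image_eigen : kernel_image e (fun x => kappa * e x).
Proof. by move=> y Dy; rewrite e_eigen// mulrA. Qed.

Lemma domain_nonnull : mu D != 0%E.
Proof.
apply/eqP => D0; have : ip e e = 0.
  rewrite /ip /Rintegral null_set_integral//.
  exact: measurable_int (integrable_L2M mD mm m_gt0 e_L2 e_L2).
by rewrite e_norm => /eqP; rewrite oner_eq0.
Qed.

(** At any single point of [D] the eigenvalue equation equates a positive integral with [kappa]
    times a positive number. *)
Lemma kappa_gt0 : 0 < kappa.
Proof.
have [y Dy _] : exists2 x, D x & True.
  by apply: (ae_in_nonnull mD domain_nonnull); exact: aeW.
rewrite -(pmulr_lgt0 _ (mulr_gt0 (e_gt0 Dy) (m_gt0 Dy))) -e_eigen//.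
apply: (Rintegral_gt0 mD domain_nonnull); first exact: K_int.
by move=> z Dz; rewrite mulr_gt0 ?K_gt0 ?e_gt0.
Qed.

Let mfst (f : T -> R) : measurable_fun D f ->
  measurable_fun (D `*` D) (fun z : T * T => f z.1).
Proof.
move=> mf; apply: (measurable_comp (f := f) mD) => //.
- by move=> _ [z [Dz _] <-].
- exact: measurable_funTS measurable_fst.
Qed.

Let msnd (f : T -> R) : measurable_fun D f ->
  measurable_fun (D `*` D) (fun z : T * T => f z.2).
Proof.
move=> mf; apply: (measurable_comp (f := f) mD) => //.
- by move=> _ [z [_ Dz] <-].
- exact: measurable_funTS measurable_snd.
Qed.

Let me : measurable_fun D e. Proof. by case: e_L2. Qed.

Let mVe : measurable_fun D (fun x => (e x)^-1).
Proof. exact: measurable_fun_inv_gt0. Qed.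

(** Tonelli puts the integral in [x] inside, where the symmetry of [K] turns it into the eigenvalue
    equation at [y]. Both sides may be infinite. *)
Lemma integral_kernel_eigen (q : T -> R) : measurable_fun D q ->
  (forall y, D y -> 0 <= q y) ->
  (\int[mu]_(x in D) \int[mu]_(y in D) (e x * K x y * q y)%:E =
   \int[mu]_(y in D) (kappa * (e y * m y) * q y)%:E)%E.
Proof.
move=> mq q0.
rewrite (tonelli_in mu mu (F := fun z : T * T => (e z.1 * K z.1 z.2 * q z.2)%:E))//=.
- apply: eq_integral => y /set_mem Dy.
  have eKi := K_int e_L2 Dy.
  rewrite -e_eigen// mulrC EFinM fineK ?integrable_fin_num//.
  rewrite -integralZl//; apply: eq_integral => x /set_mem Dx.
  by rewrite K_sym// -EFinM; congr EFin; ring.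
- apply/measurable_EFinP; apply: measurable_funM; last exact: msnd.
  by apply: measurable_funM => //; exact: mfst.
- move=> z [Dz1 Dz2]; rewrite lee_fin.
  by rewrite mulr_ge0 ?q0// mulr_ge0 ?ltW ?e_gt0 ?K_gt0.
Qed.

Let energy_density (f g : T -> R) (x y : T) : R :=
  e x * K x y * e y * (f y / e y - g x / e x) ^+ 2.

Let energy_density_ge0 f g x y : D x -> D y -> 0 <= energy_density f g x y.
Proof.
move=> Dx Dy; rewrite mulr_ge0 ?sqr_ge0//.
by rewrite mulr_ge0 ?mulr_ge0 ?ltW ?e_gt0 ?K_gt0.
Qed.

Let measurable_energy_density f g : measurable_fun D f -> measurable_fun D g ->
  measurable_fun (D `*` D)
    (fun z : T * T => (energy_density f g z.1 z.2)%:E).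
Proof.
move=> mf mg; apply/measurable_EFinP; apply: measurable_funM.
  apply: measurable_funM; last exact: msnd.
  by apply: measurable_funM => //; exact: mfst.
apply: measurable_funX; apply: measurable_funB.
  by apply: (msnd (f := fun y => f y / e y)); exact: measurable_funM.
by apply: (mfst (f := fun y => g y / e y)); exact: measurable_funM.
Qed.

(* Expanding the square, the [f]-term is evaluated by Tonelli and the eigenvalue
   equation, while the cross term and the [g]-term are inner integrals of [K]
   against [f] and [e]. *)
Lemma schur_energy (f g h : T -> R) : L2 f -> L2 g -> L2 h ->
  kernel_image f h ->
  (\int[mu]_(x in D) \int[mu]_(y in D)
     (e x * K x y * e y * (f y / e y - g x / e x) ^+ 2)%:E)%E =
  (kappa * ip f f - 2 * ip h g + kappa * ip g g)%:E.
Proof.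
move=> Lf Lg Lh fh; have [mf _] := Lf; have [mg _] := Lg.
pose q y := f y ^+ 2 / e y.
have mq : measurable_fun D q.
  by apply: measurable_funM => //; exact: measurable_funX.
have q0 y : D y -> 0 <= q y.
  by move=> Dy; rewrite mulr_ge0 ?sqr_ge0// invr_ge0 ltW ?e_gt0.
(* The $f$-part of the inner integral, kept extended-valued: it is only known to be finite for
   almost every [x]. *)
pose A x := (\int[mu]_(y in D) (e x * K x y * q y)%:E)%E.
have A0 x : D x -> (0 <= A x)%E.
  move=> Dx; apply: integral_ge0 => y Dy; rewrite lee_fin.
  by rewrite mulr_ge0 ?q0// mulr_ge0 ?ltW ?e_gt0 ?K_gt0.
have mA : measurable_fun D A.
  apply: (measurable_fun_integral_in mu
    (F := fun z : T * T => (e z.1 * K z.1 z.2 * q z.2)%:E)) => //=.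
    apply/measurable_EFinP; apply: measurable_funM; last exact: msnd.
    by apply: measurable_funM => //; exact: mfst.
  move=> z [Dz1 Dz2]; rewrite lee_fin.
  by rewrite mulr_ge0 ?q0// mulr_ge0 ?ltW ?e_gt0 ?K_gt0.
have IA : (\int[mu]_(x in D) A x = (kappa * ip f f)%:E)%E.
  have ffi := integrable_L2M mD mm m_gt0 Lf Lf.
  rewrite integral_kernel_eigen// EFinM fineK ?integrable_fin_num//.
  rewrite -integralZl//; apply: eq_integral => y /set_mem Dy.
  rewrite -EFinM; congr EFin; rewrite /q; field.
  by rewrite gt_eqF ?e_gt0.
have iA : mu.-integrable D A.
  apply/integrableP; split => //.
  rewrite (_ : \int[mu]_(x in D) _ = \int[mu]_(x in D) A x)%E.
    by rewrite IA ltry.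
  by apply: eq_integral => x /set_mem/A0/gee0_abs.
(* The cross term and the $g$-term after integration in [y]. *)
pose B x := (- 2) * (h x * g x * m x) + kappa * (g x * g x * m x).
have hgi := integrable_L2M mD mm m_gt0 Lh Lg.
have ggi := integrable_L2M mD mm m_gt0 Lg Lg.
have kggi : mu.-integrable D (EFin \o (fun x => kappa * (g x * g x * m x))).
  have := integrableZl mD kappa ggi.
  by apply: eq_integrable => // x _ /=; rewrite EFinM.
have iB : mu.-integrable D (EFin \o B) by exact: integrable_lin.
transitivity (\int[mu]_(x in D) (A x + (B x)%:E))%E; last first.
  rewrite integralD// IA -[X in (_ + X)%E]fineK ?integrable_fin_num//.
  rewrite -/(Rintegral _ _ _) Rintegral_lin// RintegralZl// -EFinD.
  by congr EFin; rewrite -/(ip h g) -/(ip g g); ring.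
apply: ae_eq_integral => //.
- apply: (measurable_fun_integral_in mu
    (F := fun z : T * T => (energy_density f g z.1 z.2)%:E)) => //=.
    exact: measurable_energy_density.
  by move=> z [Dz1 Dz2]; rewrite lee_fin energy_density_ge0.
- apply: emeasurable_funD => //; exact: measurable_int iB.
(* The inner integral is split into [A x] and [B x] only where [A x] is finite, hence almost
   everywhere. *)
- apply: filterS (integrable_ae mD iA) => x + Dx => /(_ Dx) Ax.
  have ex0 := e_gt0 Dx; have Kf := K_int Lf Dx; have Ke := K_int e_L2 Dx.
  have iAx : mu.-integrable D (fun y => (e x * K x y * q y)%:E).
    apply/integrableP; split.
      apply/measurable_EFinP.
      (* Measurability in [y] is read off from the integrable product [K x y * e y]. *)
      apply: (eq_measurable_fun (fun y => e x * (K x y * e y) * (q y / e y))).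
        move=> y /set_mem/e_gt0 ey; field.
        by rewrite gt_eqF.
      apply: measurable_funM; last exact: measurable_funM.
      apply: measurable_funM => //.
      by apply/measurable_EFinP; exact: measurable_int Ke.
    rewrite (_ : \int[mu]_(y in D) _ = A x)%E ?ltey_eq ?Ax//.
    apply: eq_integral => y /set_mem Dy; rewrite gee0_abs// lee_fin.
    by rewrite mulr_ge0 ?q0// mulr_ge0 ?ltW ?e_gt0 ?K_gt0.
  have Kei : mu.-integrable D (EFin \o (fun y => g x ^+ 2 / e x * (K x y * e y))).
    have := integrableZl mD (g x ^+ 2 / e x) Ke.
    by apply: eq_integrable => // y _ /=; rewrite EFinM.
  pose r y := (- 2 * g x) * (K x y * f y) + g x ^+ 2 / e x * (K x y * e y).
  have ir : mu.-integrable D (EFin \o r) by exact: integrable_lin.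
  rewrite [LHS](_ : _ = \int[mu]_(y in D) ((e x * K x y * q y)%:E + (r y)%:E))%E.
    rewrite integralD//; congr (_ + _)%E.
    rewrite -[LHS]fineK ?integrable_fin_num// -/(Rintegral _ _ _).
    rewrite Rintegral_lin// RintegralZl// e_eigen// -fh//; congr EFin.
    by rewrite /B; field; rewrite gt_eqF.
  apply: eq_integral => y /set_mem/e_gt0 ey; rewrite -EFinD; congr EFin.
  by rewrite /q /r; field; rewrite !gt_eqF.
Qed.

Lemma schur_form_ge0 (f g h : T -> R) : L2 f -> L2 g -> L2 h ->
  kernel_image f h -> 0 <= kappa * ip f f - 2 * ip h g + kappa * ip g g.
Proof.
move=> Lf Lg Lh fh; rewrite -lee_fin -schur_energy//.
apply: integral_ge0 => x Dx; apply: integral_ge0 => y Dy.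
by rewrite lee_fin energy_density_ge0.
Qed.

(** The choice $g = h/\kappa$ minimises the Schur form in $g$, so its nonnegativity there is the
    norm bound and its vanishing there is the equality case. *)
Let schur_form_image (f h : T -> R) : L2 f -> L2 h ->
  kappa * ip f f - 2 * ip h (fun x => kappa^-1 * h x) +
  kappa * ip (fun x => kappa^-1 * h x) (fun x => kappa^-1 * h x) =
  kappa^-1 * (kappa ^+ 2 * ip f f - ip h h).
Proof.
move=> Lf Lh; have Lkh := L2Z mD mm m_gt0 kappa^-1 Lh.
rewrite ipZl// ipC ipZl//; field.
by rewrite gt_eqF ?kappa_gt0.
Qed.

Lemma kernel_image_contraction (f h : T -> R) : L2 f -> L2 h ->
  kernel_image f h -> ip h h <= kappa ^+ 2 * ip f f.
Proof.
move=> Lf Lh fh.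
have := schur_form_ge0 Lf (L2Z mD mm m_gt0 kappa^-1 Lh) Lh fh.
by rewrite schur_form_image// pmulr_rge0 ?invr_gt0 ?kappa_gt0// subr_ge0.
Qed.

(* [schur_form_ge0] at [e + s f] and [e] vanishes at [s = 0], so its derivative
   in [s] does too. *)
Lemma ip_kernel_image_eigen (f h : T -> R) : L2 f -> L2 h ->
  kernel_image f h -> ip h e = kappa * ip f e.
Proof.
move=> Lf Lh fh; have k0 := kappa_gt0.
have Lke := L2Z mD mm m_gt0 kappa e_L2.
have q (s : R) : 0 <= 2 * s * (kappa * ip f e - ip h e) + kappa * s ^+ 2 * ip f f.
  have := schur_form_ge0 (L2_lin mD mm m_gt0 s Lf e_L2) e_L2
    (L2_lin mD mm m_gt0 s Lh Lke)
    (kernel_image_lin s Lf e_L2 fh kernel_image_eigen).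
  rewrite ip_sqr_lin// ip_linl// ipZl// e_norm.
  by congr (0 <= _); ring.
apply/eqP; rewrite eq_sym -subr_eq0; apply/eqP.
set a := _ - _ in q *; set c := kappa * ip f f.
have c0 : 0 <= c by rewrite mulr_ge0 ?ip_ge0// ltW.
(* Near the minimiser $-a/c$, with $c+1$ in place of $c$ to allow $c = 0$; the value is a negative
   multiple of $a^2$. *)
have := q (- a / (c + 1)).
rewrite (_ : _ + _ = - (a ^+ 2 * (c + 2)) / (c + 1) ^+ 2); last first.
  by rewrite /c; field; rewrite -/c gt_eqF ?ltr_wpDl.
rewrite pmulr_lge0 ?invr_gt0 ?exprn_gt0 ?ltr_wpDl// oppr_ge0.
rewrite pmulr_lle0 ?ltr_wpDl// => a2.
by apply/eqP; rewrite -sqrf_eq0 eq_le a2 sqr_ge0.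
Qed.

(* In the equality case the energy vanishes, so [f / e] is constant. *)
Lemma kernel_image_isometry_eq0 (f h : T -> R) : L2 f -> L2 h ->
  kernel_image f h -> ip h h = kappa ^+ 2 * ip f f -> ip f e = 0 -> ip f f = 0.
Proof.
move=> Lf Lh fh hf fe0.
pose g x := kappa^-1 * h x.
have Lg : L2 g := L2Z mD mm m_gt0 kappa^-1 Lh.
have [mf _] := Lf; have [mg _] := Lg.
(* One [x] with zero inner energy is enough: it makes $f/e$ almost everywhere equal to the constant
   [g x / e x]. *)
have [x Dx] : exists2 x, D x &
    (\int[mu]_(y in D) (energy_density f g x y)%:E = 0)%E.
  apply: (ae_in_nonnull mD domain_nonnull); apply: (integral_eq0_ae mD).
  - apply: (measurable_fun_integral_in mu
      (F := fun z : T * T => (energy_density f g z.1 z.2)%:E)) => //=.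
      exact: measurable_energy_density.
    by move=> z [Dz1 Dz2]; rewrite lee_fin energy_density_ge0.
  - move=> x Dx; apply: integral_ge0 => y Dy.
    by rewrite lee_fin energy_density_ge0.
  - by rewrite (schur_energy Lf Lg Lh fh) schur_form_image// hf subrr mulr0.
have mKe : measurable_fun D (fun y => K x y * e y).
  by apply/measurable_EFinP; exact: measurable_int (K_int e_L2 Dx).
move=> /(integral_eq0_ae mD) ae0.
have {}ae0 : {ae mu, forall y, D y -> f y = g x / e x * e y}.
  apply: filterS (ae0 _ _) => [y + Dy|//|y Dy].
  - move=> /(_ Dy)[] /eqP; rewrite mulf_eq0 sqrf_eq0 subr_eq0.
    rewrite gt_eqF ?mulr_gt0 ?e_gt0 ?K_gt0//= => /eqP <-.
    by rewrite divfK// gt_eqF ?e_gt0.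
  - apply/measurable_EFinP.
    apply: (eq_measurable_fun (fun y => e x * (K x y * e y) * (f y / e y - g x / e x) ^+ 2)).
      by move=> y _; rewrite /energy_density; ring.
    apply: measurable_funM; first exact: measurable_funM.
    by apply: measurable_funX; apply: measurable_funB => //; exact: measurable_funM.
  - by rewrite lee_fin energy_density_ge0.
have fei := integrable_L2M mD mm m_gt0 Lf e_L2.
(* Since [f] is almost everywhere a multiple of [e], its squared norm is a multiple of [ip f e]. *)
suff -> : ip f f = g x / e x * ip f e by rewrite fe0 mulr0.
rewrite /ip -RintegralZl//; congr fine; apply: ae_eq_integral => //.
- exact: measurable_int (integrable_L2M mD mm m_gt0 Lf Lf).
- apply/measurable_EFinP; apply: measurable_funM => //.
  by apply/measurable_EFinP; exact: measurable_int fei.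
- apply: filterS ae0 => y + Dy => /(_ Dy) fy.
  by congr EFin; rewrite {2}fy; ring.
Qed.

End SchurEnergy.

(** * Convergence of the normalised power iteration *)

Lemma cvg_increasing_nat (s : nat -> nat) :
  {homo s : a b / (a < b)%N >-> (a < b)%N} -> s @ \oo --> \oo.
Proof.
move=> s_incr; have le_s n : (n <= s n)%N.
  by elim: n => [//|n IHn]; exact: leq_ltn_trans (s_incr _ _ (ltnSn n)).
by move=> A [N _ AN]; exists N => // n /= Nn; apply: AN; exact: leq_trans Nn _.
Qed.

Section PowerIteration.
Context d (T : measurableType d) (R : realType).
Variable mu : {sigma_finite_measure set T -> \bar R}.
Variables (D : set T) (m e k0 : T -> R) (K : T -> T -> R) (kappa C : R).
Hypothesis mD : measurable D.
Hypothesis mm : measurable_fun D m.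
Hypothesis m_gt0 : forall x, D x -> 0 < m x.
Hypothesis mK : measurable_fun (D `*` D) (fun z : T * T => K z.1 z.2).
Hypothesis mKr : forall x, D x -> measurable_fun D (K x).
Hypothesis K_gt0 : forall x y, D x -> D y -> 0 < K x y.
Hypothesis K_sym : forall x y, D x -> D y -> K x y = K y x.
Hypothesis k0_gt0 : forall x, D x -> 0 < k0 x.
Hypothesis k0_L2 : L2 mu D m (fun x => k0 x / m x).
Hypothesis K_le_k0 : forall x y, D x -> D y -> K x y <= C * k0 y.
Hypothesis e_L2 : L2 mu D m e.
Hypothesis e_gt0 : forall x, D x -> 0 < e x.
Hypothesis e_norm : ip mu D m e e = 1.
Hypothesis e_eigen : forall y, D y ->
  \int[mu]_(z in D) (K y z * e z) = kappa * (e y * m y).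
Variables (L : (T -> R) -> T -> R) (E : (T -> R) -> Prop).
Hypothesis L_image : forall f, E f -> kernel_image mu D m K f (L f).
Hypothesis E_L2 : forall f, E f -> L2 mu D m f.
Hypothesis E_scale : forall k f, E f -> E (fun x => k * f x).
Hypothesis E_L : forall f, E f -> E (L f).
Hypothesis L_compact : forall u : nat -> T -> R, (forall n, E (u n)) ->
  (exists M, forall n, ip mu D m (u n) (u n) <= M) ->
  exists (phi : nat -> nat) (f : T -> R),
    [/\ {homo phi : a b / (a < b)%N >-> (a < b)%N}, E f &
        (fun n => ip mu D m (fun x => L (u (phi n)) x - f x)
                            (fun x => L (u (phi n)) x - f x)) @ \oo --> (0 : R)].

Local Notation L2 := (L2 mu D m).
Local Notation ip := (ip mu D m).

(** With [k0] the kernel row at the evaluation point, this is the pointwise value of the operator up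
    to a fixed factor. It is continuous on $L^2(m)$ because $k_0/m$ belongs to $L^2(m)$. *)
Let ell (f : T -> R) : R := \int[mu]_(z in D) (k0 z * f z).

Let k0_mul (f : T -> R) z : D z -> k0 z / m z * f z * m z = k0 z * f z.
Proof. by move=> Dz; field; rewrite gt_eqF ?m_gt0. Qed.

Let k0_int (f : T -> R) : L2 f ->
  mu.-integrable D (EFin \o (fun z => k0 z * f z)).
Proof.
move=> Lf; have := integrable_L2M mD mm m_gt0 k0_L2 Lf.
by apply: eq_integrable => // z /set_mem Dz /=; rewrite k0_mul.
Qed.

Let ellE (f : T -> R) : L2 f -> ell f = ip f (fun x => k0 x / m x).
Proof.
by move=> Lf; rewrite ipC; apply: eq_Rintegral => z /set_mem Dz; rewrite k0_mul.
Qed.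

(** The bound [K_le_k0] transfers integrability against the single row [k0] to every row of the
    kernel. *)
Let K_int (f : T -> R) (y : T) : L2 f -> D y ->
  mu.-integrable D (EFin \o (fun z => K y z * f z)).
Proof.
move=> Lf Dy; have [mf _] := Lf.
have k0n := integrableZl mD C (integrable_norm (k0_int Lf)).
apply: (integrable_le mD (g := fun z => C * `|k0 z * f z|)).
- by apply: measurable_funM => //; exact: mKr.
- by move: k0n; apply: eq_integrable => // z _ /=; rewrite EFinM.
- move=> z Dz; rewrite !normrM (gtr0_norm (K_gt0 _ _))//.
  rewrite (gtr0_norm (k0_gt0 _))// mulrA.
  by rewrite ler_wpM2r// K_le_k0.
Qed.

Let k_gt0 : 0 < kappa.
Proof. exact: (kappa_gt0 mD mm m_gt0 K_gt0 K_int e_L2 e_gt0 e_norm e_eigen). Qed.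

Let k_neq0 : kappa != 0. Proof. by rewrite gt_eqF. Qed.

Let contraction (f h : T -> R) : L2 f -> L2 h -> kernel_image mu D m K f h ->
  ip h h <= kappa ^+ 2 * ip f f.
Proof.
exact: (kernel_image_contraction mD mm m_gt0 mK K_gt0 K_sym K_int
  e_L2 e_gt0 e_norm e_eigen).
Qed.

Section Iterates.
Variable g : T -> R.
Hypothesis Eg : E g.

Let c : R := ip g e.
Let u (n : nat) (x : T) : R := kappa ^- n * iter n L g x.
Let v (n : nat) (x : T) : R := - c * e x + u n x.

Let Eiter n : E (iter n L g).
Proof. by elim: n => [//|n IHn]; exact: E_L. Qed.

Let Eu n : E (u n). Proof. exact/E_scale/Eiter. Qed.

Let Lu n : L2 (u n). Proof. exact/E_L2/Eu. Qed.

Let Lv n : L2 (v n). Proof. exact: L2_lin. Qed.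

Let u_image n : kernel_image mu D m K (u n) (fun x => kappa * u n.+1 x).
Proof.
move=> y Dy; have En := Eiter n; have Ln := E_L2 En.
have -> : kappa * u n.+1 y * m y = kappa ^- n * (L (iter n L g) y * m y).
  by rewrite /u exprS /=; field; rewrite expf_neq0 ?k_neq0.
rewrite L_image// -RintegralZl//; last exact: K_int.
by apply: eq_Rintegral => z _; rewrite /u; ring.
Qed.

Let L_u n x : D x -> L (u n) x = kappa * u n.+1 x.
Proof.
move=> Dx; have := u_image n Dx; rewrite -(L_image (Eu n) Dx).
by move/mulIf => ->//; rewrite gt_eqF ?m_gt0.
Qed.

Let v_image n : kernel_image mu D m K (v n) (fun x => kappa * v n.+1 x).
Proof.
have := kernel_image_lin mD K_int (- c) e_L2 (Lu n) (kernel_image_eigen e_eigen)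
  (u_image n).
by congr kernel_image; apply/funext => x; rewrite /v; ring.
Qed.

Let ip_ue n : ip (u n) e = c.
Proof.
elim: n => [|n IHn]; first by rewrite /u expr0 invr1 ipZl// ?mul1r//; exact: E_L2.
have Lk := L2Z mD mm m_gt0 kappa (Lu n.+1).
have := ip_kernel_image_eigen mD mm m_gt0 mK K_gt0 K_sym K_int e_L2 e_gt0
  e_norm e_eigen (Lu n) Lk (@u_image n).
by rewrite IHn ipZl// => /(mulfI k_neq0).
Qed.

Let ip_ve n : ip (v n) e = 0.
Proof. by rewrite ip_linl// e_norm ip_ue; ring. Qed.

Let N n := ip (v n) (v n).

Let N_nonincr : nonincreasing_seq N.
Proof.
apply/nonincreasing_seqP => n.
have Lk := L2Z mD mm m_gt0 kappa (Lv n.+1).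
have := contraction (Lv n) Lk (@v_image n); rewrite ipZl// ipC ipZl//.
by rewrite mulrA -expr2 ler_pM2l// exprn_gt0.
Qed.

(** [N] decreases and is nonnegative, so all its subsequences share one limit; this fixes the norm
    of any strong limit of multiples of a subsequence of [v]. *)
Let cvg_v_sub (s : nat -> nat) (k : R) (G : T -> R) : L2 G ->
  {homo s : a b / (a < b)%N >-> (a < b)%N} ->
  (fun n => ip (fun x => k * v (s n) x - G x) (fun x => k * v (s n) x - G x))
    @ \oo --> (0 : R) ->
  ip G G = k ^+ 2 * limn N.
Proof.
move=> LG s_incr sG.
have cN : cvgn N.
  apply: nonincreasing_is_cvgn => //; exists 0 => _ [n _ <-]; exact: ip_ge0.
have := cvg_ip_sqr mD mm m_gt0 (fun n => L2Z mD mm m_gt0 k (Lv (s n))) LG sG.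
have -> : (fun n => ip (fun x => k * v (s n) x) (fun x => k * v (s n) x)) =
    (fun n => k ^+ 2 * N (s n)).
  apply/funext => n; have Lk := L2Z mD mm m_gt0 k (Lv (s n)).
  by rewrite ipZl// ipC ipZl// /N; ring.
move=> l1; have l2 : (fun n => k ^+ 2 * N (s n)) @ \oo --> k ^+ 2 * limn N.
  apply: cvgM; first exact: cvg_cst.
  exact: (@cvg_comp _ _ _ s N _ _ _ (cvg_increasing_nat s_incr) cN).
exact: (cvg_unique _ l1 l2).
Qed.

Let u_bounded n : ip (u n) (u n) <= ip (u 0) (u 0).
Proof.
elim: n => [//|n]; apply: le_trans.
have Lk := L2Z mD mm m_gt0 kappa (Lu n.+1).
have := contraction (Lu n) Lk (@u_image n); rewrite ipZl// ipC ipZl//.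
by rewrite mulrA -expr2 ler_pM2l// exprn_gt0.
Qed.

Let lim_N : limn N = 0.
Proof.
(* Compactness is applied to [u], which stays in [E] by scaling; the centred sequence [v] is
   followed through [kernel_image] only. *)
have [phi [F [phi_incr EF cF]]] := L_compact Eu (ex_intro _ _ u_bounded).
have LF := E_L2 EF.
(* As $L u_n = \kappa u_{n+1}$, the convergence $L u_{\varphi(n)} \to F$ says that $\kappa
   v_{\varphi(n)+1} \to G$; applying the operator once more, $\kappa^2 v_{\varphi(n)+2} \to H$, the
   image of $G$. *)
pose G x := - (kappa * c) * e x + F x.
pose H x := - (kappa * c) * (kappa * e x) + L F x.
have LG : L2 G by exact: L2_lin.
have LH : L2 H by apply: L2_lin => //; [exact: L2Z|exact/E_L2/E_L].
have GH : kernel_image mu D m K G H.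
  apply: (kernel_image_lin mD K_int) => //; last exact: L_image.
  exact: kernel_image_eigen.
pose w n x := -1 * G x + kappa * v (phi n).+1 x.
have Lkv k n : L2 (fun x => k * v n x) by exact: L2Z.
have Lw n : L2 (w n) by exact: L2_lin.
have w0 : (fun n => ip (w n) (w n)) @ \oo --> (0 : R).
  suff -> : (fun n => ip (w n) (w n)) =
      (fun n => ip (fun x => L (u (phi n)) x - F x)
                   (fun x => L (u (phi n)) x - F x)) by exact: cF.
  apply/funext => n.
  by apply: eq_ip => x Dx; rewrite L_u// /w /G /v; ring.
pose w' n x := -1 * H x + kappa * (kappa * v (phi n).+2 x).
have Lw' n : L2 (w' n) by apply: L2_lin => //; exact: L2Z.
have ww' n : kernel_image mu D m K (w n) (w' n).
  apply: (kernel_image_lin mD K_int) => //.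
  exact: (kernel_imageZ mD K_int kappa (Lv _) (v_image _)).
have w'0 : (fun n => ip (w' n) (w' n)) @ \oo --> (0 : R).
  have ub : (fun n => kappa ^+ 2 * ip (w n) (w n)) @ \oo --> (0 : R).
    by rewrite -[X in _ --> X](mulr0 (kappa ^+ 2)); apply: cvgM => //; exact: cvg_cst.
  refine (squeeze_cvgr _ (cvg_cst (0 : R)) ub); near=> n.
  by rewrite ip_ge0//= contraction.
(* Both norms are expressed through the same limit of [N], so $|H|^2 = \kappa^2 |G|^2$: the equality
   case of the contraction. *)
have HH : ip H H = (kappa ^+ 2) ^+ 2 * limn N.
  apply: (cvg_v_sub LH (s := fun n => (phi n).+2)) => [a b /phi_incr//|].
  rewrite (_ : (fun n => _) = (fun n => ip (w' n) (w' n)))//.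
  by apply/funext => n; apply: eq_ip => x _; rewrite /w'; ring.
have GG : ip G G = kappa ^+ 2 * limn N.
  apply: (cvg_v_sub LG (s := fun n => (phi n).+1)) => [a b /phi_incr//|].
  rewrite (_ : (fun n => _) = (fun n => ip (w n) (w n)))//.
  by apply/funext => n; apply: eq_ip => x _; rewrite /w; ring.
have Ge : ip G e = 0.
  have we0 := cvg_ip0 mD mm m_gt0 Lw e_L2 w0.
  have weE : (fun n => ip (w n) e) = (fun=> - ip G e).
    by apply/funext => n; rewrite ip_linl// ipZl// ip_ve; ring.
  rewrite weE in we0; apply/eqP; rewrite -oppr_eq0; apply/eqP.
  exact: (cvg_unique _ (cvg_cst (- ip G e)) we0).
have G0 : ip G G = 0.
  apply: (kernel_image_isometry_eq0 mD mm m_gt0 mK K_gt0 K_sym K_int e_L2 e_gt0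
    e_norm e_eigen LG LH GH) => //.
  by rewrite HH GG; ring.
by move/eqP: G0; rewrite GG mulf_eq0 sqrf_eq0 (negbTE k_neq0)/= => /eqP.
Unshelve. all: by end_near. Qed.

Let cvg_N : N @ \oo --> (0 : R).
Proof.
rewrite -lim_N; apply: nonincreasing_is_cvgn => //.
by exists 0 => _ [n _ <-]; exact: ip_ge0.
Qed.

Let cvg_ell_u : (fun n => ell (u n)) @ \oo --> c * ell e.
Proof.
have -> : (fun n => ell (u n)) = (fun n => c * ell e + ip (v n) (fun x => k0 x / m x)).
  apply/funext => n; rewrite !ellE// ip_linl//; ring.
rewrite -[X in _ --> X]addr0; apply: cvgD; first exact: cvg_cst.
exact: (cvg_ip0 mD mm m_gt0 Lv k0_L2 cvg_N).
Qed.

Let ell_iter n : ell (iter n L g) = kappa ^+ n * ell (u n).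
Proof.
rewrite /ell -RintegralZl//; last exact: k0_int.
apply: eq_Rintegral => z _; rewrite /u; field.
by rewrite expf_neq0.
Qed.

Lemma power_iteration_ratio : ip g e != 0 ->
  (fun n => (\int[mu]_(z in D) (k0 z * iter n.+1 L g z)) /
            (\int[mu]_(z in D) (k0 z * iter n L g z))) @ \oo --> kappa.
Proof.
move=> c0.
have elle : ell e != 0.
  rewrite gt_eqF//; apply: Rintegral_gt0 => //.
  - exact: (domain_nonnull mD mm m_gt0 e_L2 e_norm).
  - exact: k0_int.
  - by move=> z Dz; rewrite mulr_gt0 ?k0_gt0 ?e_gt0.
have cl : c * ell e != 0 by rewrite mulf_neq0.
rewrite (_ : (fun n => _) = (fun n => kappa * (ell (u n.+1) / ell (u n)))).
  rewrite -[X in _ --> X]mulr1 -(divff cl).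
  apply: cvgM; first exact: cvg_cst.
  apply: cvgM; last exact: cvgV.
  by have := cvg_ell_u; rewrite -cvg_shiftS.
apply/funext => n; rewrite -/(ell _) -/(ell _) !ell_iter exprS.
(* Division by zero gives 0, so the two quotients agree for every [n], even where the denominator
   vanishes. *)
have [->|l0] := eqVneq (ell (u n)) 0; first by rewrite mulr0 invr0 !mulr0.
by field; rewrite l0 expf_neq0.
Qed.

End Iterates.
End PowerIteration.

(** * Removing a null set from the domain of integration *)

Section NullSet.
Context d (T : measurableType d) (R : realType) (mu : {measure set T -> \bar R}).

(** Positive and negative parts are treated separately, so the identity also covers non-integrable
    [f]. *)
Lemma integral_setD_null (A N : set T) (f : T -> R) : measurable A ->
  measurable N -> mu N = 0%E -> measurable_fun A f ->
  (\int[mu]_(x in A) (f x)%:E = \int[mu]_(x in A `\` N) (f x)%:E)%E.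
Proof.
move=> mA mN N0 /measurable_EFinP mf; rewrite integralE [RHS]integralE.
by congr (_ - _)%E; apply: ge0_negligible_integral => //;
  [exact: measurable_funepos|exact: measurable_funeneg].
Qed.

End NullSet.

(** * The interval $]a,b[$ and local integrability *)

Section Intervals.
Context (R : realType) (a b : \bar R).

Lemma measurable_Iab : measurable (Iab a b).
Proof.
apply: is_interval_measurable => x y [ax xb] [ay yb] z /andP[xz zy]; split.
  by rewrite (lt_le_trans ax)// lee_fin.
by rewrite (le_lt_trans _ yb)// lee_fin.
Qed.

Lemma exists_lt_left (x : R) : (a < x%:E)%E -> exists2 c : R, (a < c%:E)%E & c < x.
Proof.
case: a => [r| |]//.
  by rewrite lte_fin => rx; exists ((r + x) / 2); rewrite ?lte_fin; lra.
by exists (x - 1); rewrite ?ltNyr//; lra.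
Qed.

Lemma exists_gt_right (x : R) : (x%:E < b)%E -> exists2 c : R, (c%:E < b)%E & x < c.
Proof.
case: b => [r| |]//.
  by rewrite lte_fin => rx; exists ((r + x) / 2); rewrite ?lte_fin; lra.
by exists (x + 1); rewrite ?ltry//; lra.
Qed.

Lemma L1loc_measurable (f : R -> R) : L1loc a b f -> measurable_fun (Iab a b) f.
Proof.
move=> fi _ Y mY.
(* The interval is the countable union of its compact subintervals with rational ends. The end
   conditions sit inside the set, so that inadmissible pairs contribute the empty set. *)
pose F (q r : rat) : set R :=
  [set x | [/\ (a < (ratr q)%:E)%E, ((ratr r)%:E < b)%E,
             ratr q <= x <= ratr r & Y (f x)]].
rewrite (_ : _ `&` _ = \bigcup_q \bigcup_r F q r).
  apply: bigcupT_measurable_rat => q; apply: bigcupT_measurable_rat => r.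
  have [aq|aq] := boolP (a < (ratr q)%:E)%E; last first.
    by rewrite (_ : F q r = set0)// -subset0 => x [] /(elimN idP aq).
  have [rb|rb] := boolP ((ratr r)%:E < b)%E; last first.
    by rewrite (_ : F q r = set0)// -subset0 => x [] _ /(elimN idP rb).
  rewrite (_ : F q r = `[ratr q, ratr r] `&` f @^-1` Y).
    by have /measurable_EFinP := measurable_int _ (fi _ _ aq rb); exact.
  by apply/seteqP; split => x /=; rewrite in_itv/= => -[].
apply/seteqP; split => [x [[/= ax xb] Yx]|x [q _ [r _ [aq rb /andP[qx xr] Yx]]]].
  have [c ac cx] := exists_lt_left ax; have [c' cb xc] := exists_gt_right xb.
  have [q] := rat_in_itvoo cx; rewrite in_itv/= => /andP[cq qx].
  have [r] := rat_in_itvoo xc; rewrite in_itv/= => /andP[xr rc].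
  exists q => //; exists r => //; split => //; last by rewrite !ltW.
  - by rewrite (lt_trans ac)// lte_fin.
  - by rewrite (lt_trans _ cb)// lte_fin.
split => //; split => /=.
  by rewrite (lt_le_trans aq)// lee_fin.
by rewrite (le_lt_trans _ rb)// lee_fin.
Qed.

End Intervals.

(** * The distribution function and the kernel $K$ *)

(* The measurable sets of [R] and of [measurableTypeR R] are convertible but carry
   different displays; [lebesgue_measure] lives on the latter. *)
Section Density.
Context (R : realType) (a b : \bar R) (p : R -> R) (N : set R).
Local Notation leb := (@lebesgue_measure R).
Local Notation I := (Iab a b).
Local Notation D := (I `\` N).
Local Notation P := (Pcdf a b p).
Local Notation K := (Kker a b p).
Local Notation measurableR := (@measurable _ (measurableTypeR R)).
Local Notation measurable_funR := (@measurable_fun _ _ (measurableTypeR R) R).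
Hypothesis mN : measurableR N.
Hypothesis N0 : leb N = 0%E.
Hypothesis p_density : is_density a b p.
Hypothesis p_gt0 : forall x, D x -> 0 < p x.

Let mI : measurableR I. Proof. exact: measurable_Iab. Qed.

Let mD : measurableR D.
Proof. exact: measurableD. Qed.

Let mp : measurable_funR I p. Proof. by case: p_density. Qed.

Let mpD : measurable_funR D p.
Proof. exact: (measurable_funS mI (@subDsetl _ _ _) mp). Qed.

Let Ip : (\int[leb]_(x in D) (p x)%:E = 1)%E.
Proof.
case: p_density => _ <- _; rewrite /intI; apply/esym.
exact: (integral_setD_null mI mN N0 mp).
Qed.

Let ip : leb.-integrable D (EFin \o p).
Proof.
apply/integrableP; split; first exact/measurable_EFinP.
apply: (@le_lt_trans _ _ 1%E); last exact: ltry.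
rewrite -Ip le_eqVlt; apply/orP; left; apply/eqP.
by apply: eq_integral => x /set_mem/p_gt0/ltW; rewrite -lee_fin => /gee0_abs.
Qed.

Let mDl x : measurableR (D `&` `]-oo, x]). Proof. exact: measurableI. Qed.

Let mDr x : measurableR (D `&` `]x, +oo[). Proof. exact: measurableI. Qed.

Let ipl x : leb.-integrable (D `&` `]-oo, x]) (EFin \o p).
Proof. exact: (integrableS mD (mDl x) (@subIsetl _ _ _) ip). Qed.

Let PE x : P x = \int[leb]_(y in D `&` `]-oo, x]) p y.
Proof.
congr fine; rewrite (_ : [set y | _] = I `&` `]-oo, x]); last first.
  by apply/seteqP; split => y /=; rewrite in_itv.
have mIx : measurableR (I `&` `]-oo, x]) by exact: measurableI.
rewrite (integral_setD_null mIx mN N0) ?setIDAC ?setIDA//.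
exact: (measurable_funS mI (@subIsetl _ _ _) mp).
Qed.

Let PEc x : 1 - P x = \int[leb]_(y in D `&` `]x, +oo[) p y.
Proof.
apply/eqP; rewrite subr_eq PE addrC -(Rintegral_setU (mDl x) (mDr x)).
- rewrite -setIUr (_ : `]-oo, x] `|` _ = setT); last first.
    apply/seteqP; split => // y _ /=; rewrite !in_itv/= andbT.
    by case: leP; [left|right].
  by rewrite setIT /Rintegral Ip.
- apply: (integrableS mD (measurableU _ _ (mDl x) (mDr x)) _ ip).
  by rewrite -setIUr; exact: subIsetl.
- apply/disj_setPS => y [[_ /=]]; rewrite in_itv/= => yx [_ /=].
  by rewrite in_itv/= andbT ltNge yx.
Qed.

Lemma Pcdf_ge0 x : 0 <= P x.
Proof. by rewrite PE; apply: Rintegral_ge0 => y [/p_gt0/ltW]. Qed.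

Lemma Pcdf_le1 x : P x <= 1.
Proof. by rewrite -subr_ge0 PEc; apply: Rintegral_ge0 => y [/p_gt0/ltW]. Qed.

Lemma Pcdf_nondecreasing : {homo P : x y / x <= y}.
Proof.
move=> x y xy; rewrite !PE; apply: fine_le; rewrite ?integrable_fin_num//.
apply: ge0_subset_integral => //; first exact: measurable_int (ipl y).
  by move=> z [/p_gt0/ltW]; rewrite lee_fin.
by apply: setIS => z /=; rewrite !in_itv/= => /le_trans; exact.
Qed.

(** Up to the null set [N], the intersection contains an interval of positive length. Applied on
    either side of a point, this gives $0 < P < 1$. *)
Let itv_nonnull c d A : c < d -> I c -> I d -> measurableR A -> `]c, d] `<=` A ->
  leb (D `&` A) != 0%E.
Proof.
move=> cd [ac _] [_ db] mA cdA; apply/eqP => DA0.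
have : (leb `]c, d] <= leb (D `&` A) + leb N)%E.
  apply: (@le_trans _ _ (leb ((D `&` A) `|` N))).
    apply: le_measure; rewrite ?inE//.
      by apply: measurableU => //; exact: measurableI.
    move=> y cdy; have [Ny|nNy] := pselect (N y); [by right|left].
    split; last exact: cdA.
    move: cdy; rewrite /= in_itv/= => /andP[cy yd]; split => //; split => /=.
      by rewrite (lt_trans ac)// lte_fin.
    by rewrite (le_lt_trans _ db)// lee_fin.
  by apply: measureU2 => //; exact: measurableI.
rewrite DA0 N0 adde0 lebesgue_measure_itv/= lte_fin cd -EFinB lee_fin.
by rewrite leNgt subr_gt0 cd.
Qed.

Lemma Pcdf_gt0 x : I x -> 0 < P x.
Proof.
move=> [ax xb]; rewrite PE; apply: Rintegral_gt0 => //; last by move=> y [/p_gt0].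
have [c ac cx] := exists_lt_left ax.
apply: (itv_nonnull cx) => //; first by split => //; rewrite (lt_trans _ xb)// lte_fin.
by move=> y /=; rewrite !in_itv/= => /andP[].
Qed.

Lemma Pcdf_lt1 x : I x -> P x < 1.
Proof.
move=> [ax xb]; rewrite -subr_gt0 PEc; apply: Rintegral_gt0 => //.
- have [c cb xc] := exists_gt_right xb.
  apply: (itv_nonnull xc) => //; first by split => //; rewrite (lt_trans ax)// lte_fin.
  by move=> y /=; rewrite !in_itv/= andbT => /andP[].
- exact: (integrableS mD (mDr x) (@subIsetl _ _ _) ip).
- by move=> y [/p_gt0].
Qed.

Lemma Kker_gt0 x y : I x -> I y -> 0 < K x y.
Proof.
move=> Ix Iy; rewrite /Kker mulr_gt0 ?subr_gt0//.
  by apply: Pcdf_gt0; rewrite /Num.min; case: ifP.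
by apply: Pcdf_lt1; rewrite /Num.max; case: ifP.
Qed.

Lemma KkerC x y : K x y = K y x.
Proof. by rewrite /Kker minC maxC. Qed.

Let mP : measurable_fun setT P.
Proof. exact: nondecreasing_measurable Pcdf_nondecreasing. Qed.

Lemma measurable_Kker : measurable_fun setT (fun z : R * R => K z.1 z.2).
Proof.
apply: measurable_funM.
  by apply: (measurableT_comp mP); exact: measurable_minr.
apply: measurable_funB => //.
by apply: (measurableT_comp mP); exact: measurable_maxr.
Qed.

Lemma measurable_Kker_r x : measurable_fun setT (K x).
Proof.
apply: measurable_funM.
  by apply: (measurableT_comp mP); exact: measurable_minr.
apply: measurable_funB => //.
by apply: (measurableT_comp mP); exact: measurable_maxr.
Qed.

(** A Harnack-type bound, from monotonicity of $P$ and factors at most 1. For $x \le z$, $K(y,z) \le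
    \bar P(z)$ while $K(x,z) = P(x)\bar P(z)$; for $z < x$, $K(y,z) \le P(z)$ while $K(x,z) =
    P(z)\bar P(x)$. *)
Lemma Kker_le x y z : I x -> K y z <= (P x * (1 - P x))^-1 * K x z.
Proof.
move=> Ix; have P0 := Pcdf_gt0 Ix; have P1 := Pcdf_lt1 Ix.
have Q0 : 0 < 1 - P x by rewrite subr_gt0.
rewrite mulrC ler_pdivlMr ?mulr_gt0//.
have h1 := Pcdf_ge0 (Num.min y z); have h2 := Pcdf_le1 (Num.min y z).
have h3 := Pcdf_ge0 (Num.max y z); have h4 := Pcdf_le1 (Num.max y z).
have h5 : P (Num.min y z) <= P z by apply: Pcdf_nondecreasing; rewrite ge_min lexx orbT.
have h6 : P z <= P (Num.max y z) by apply: Pcdf_nondecreasing; rewrite le_max lexx orbT.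
have h7 := Pcdf_ge0 z; have h8 := Pcdf_le1 z.
rewrite /Kker; case: (leP x z) => _.
  rewrite [leRHS](_ : _ = 1 * (1 - P z) * (P x * 1)); last by ring.
  by apply: ler_pM; [nra|nra|apply: ler_pM; lra|apply: ler_pM; lra].
rewrite [leRHS](_ : _ = P z * 1 * (1 * (1 - P x))); last by ring.
by apply: ler_pM; [nra|nra|apply: ler_pM; lra|apply: ler_pM; lra].
Qed.

End Density.

(** * Passing from $]a,b[$ to the complement of a null set *)

Section WeightedSpaces.
Context (R : realType) (a b : \bar R) (N : set R).
Local Notation leb := (@lebesgue_measure R).
Local Notation I := (Iab a b).
Local Notation D := (I `\` N).
Local Notation measurableR := (@measurable _ (measurableTypeR R)).
Local Notation measurable_funR := (@measurable_fun _ _ (measurableTypeR R) R).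
Hypothesis mN : measurableR N.
Hypothesis N0 : leb N = 0%E.

Let mI : measurableR I. Proof. exact: measurable_Iab. Qed.

Let mD : measurableR D. Proof. exact: measurableD. Qed.

Lemma intI_setD (f : R -> R) : measurable_funR I f ->
  intI a b f = (\int[leb]_(x in D) (f x)%:E)%E.
Proof. exact: (integral_setD_null mI mN N0). Qed.

Section Weight.
Variable m : R -> R.
Hypothesis mm : measurable_funR I m.
Hypothesis m_gt0 : forall x, D x -> 0 < m x.

Lemma L2w_L2 (f : R -> R) : L2w a b m f -> L2 leb D m f.
Proof.
move=> [mf foo].
have mfm : measurable_funR I (fun x => f x ^+ 2 * m x).
  by apply: measurable_funM => //; exact: measurable_funX.
split; first exact: (measurable_funS mI (@subDsetl _ _ _) mf).
apply/integrableP; split.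
  by apply/measurable_EFinP; exact: (measurable_funS mI (@subDsetl _ _ _) mfm).
apply: le_lt_trans foo; rewrite intI_setD// le_eqVlt; apply/orP; left; apply/eqP.
apply: eq_integral => x /set_mem/m_gt0/ltW mx.
by rewrite /= ger0_norm// mulr_ge0 ?sqr_ge0.
Qed.

Lemma L2_L2w (f : R -> R) : measurable_funR I f -> L2 leb D m f -> L2w a b m f.
Proof.
move=> mf [_ fi]; split => //; rewrite intI_setD; first exact: integrable_lty.
by apply: measurable_funM => //; exact: measurable_funX.
Qed.

Lemma L2wZ (k : R) (f : R -> R) : L2w a b m f -> L2w a b m (fun x => k * f x).
Proof.
move=> Lf; have [mf _] := Lf; apply: L2_L2w; first exact: measurable_funM.
apply: L2Z (L2w_L2 Lf) => //.
exact: (measurable_funS mI (@subDsetl _ _ _) mm).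
Qed.

Lemma ip_intI (f g : R -> R) : measurable_funR I f -> measurable_funR I g ->
  ip leb D m f g = fine (intI a b (fun x => f x * g x * m x)).
Proof.
move=> mf mg; rewrite intI_setD//.
by apply: measurable_funM => //; exact: measurable_funM.
Qed.

End Weight.

Lemma eq_L2w (m f g : R -> R) : (forall x, I x -> f x = g x) ->
  L2w a b m f -> L2w a b m g.
Proof.
move=> fg [mf foo]; split.
  by apply: eq_measurable_fun mf => x /set_mem/fg.
rewrite (_ : intI a b _ = intI a b (fun x => f x ^+ 2 * m x))//.
by apply: eq_integral => x /set_mem/fg ->.
Qed.

Lemma primZ (x0 k : R) (f : R -> R) (x : R) : L1loc a b f -> I x0 -> I x ->
  prim x0 (fun y => k * f y) x = k * prim x0 f x.
Proof.
move=> fi [ax0 x0b] [ax xb]; rewrite /prim; case: ifP => _.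
  by rewrite -[LHS]/(Rintegral leb _ _) RintegralZl//; exact: fi.
rewrite mulrN -[X in - X]/(Rintegral leb _ _) RintegralZl//; exact: fi.
Qed.

(** Makes the normalised iterates $\kappa^{-n} L^n g_0$ admissible in the compactness hypothesis. *)
Lemma E2Z (p w : R -> R) (k : R) (f : R -> R) :
  measurable_funR I p -> (forall x, D x -> 0 < p x) ->
  measurable_funR I (fun x => p x * w x) ->
  (forall x, D x -> 0 < p x * w x) ->
  E2 a b p w f -> E2 a b p w (fun x => k * f x).
Proof.
move=> mp p0 mpw pw0 [Lf fi [x0 Ix0 Lprim]]; split.
- exact: L2wZ.
- move=> c d ac db; have mcd : measurableR `[c, d] by exact: measurable_itv.
  have := integrableZl mcd k (fi c d ac db).
  by apply: eq_integrable => // x _ /=; rewrite EFinM.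
- exists x0; first exact: Ix0.
  apply: (@eq_L2w p (fun x => k * prim x0 f x)); last exact: L2wZ.
  by move=> x Ix; rewrite primZ.
Qed.

End WeightedSpaces.

(** * Application to the Poincaré operator *)

Theorem theorem3p8 (R : realType) (a b : \bar R) (p w : R -> R) (e1 : R -> R)
    (x : R) (g0 : R -> R) :
  (a < b)%E ->
  is_density a b p -> is_weight a b p w ->
  H1 a b p w -> H2 a b p w ->
  Lt_compact a b p w ->
  pos_eigvec a b p w (fine (Cpw a b p w)) e1 ->
  Iab a b x -> 0 < p x -> 0 < w x ->
  L2w a b (fun y => p y * w y) (kw a b p w x) ->
  E2 a b p w g0 ->
  intI a b (fun y => g0 y * e1 y * w y * p y) != 0%E ->
  (fun n => Kval a b p x (Lt_iter a b p w n.+1 g0) / Kval a b p x (Lt_iter a b p w n g0))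
    @ \oo --> fine (Cpw a b p w).
Proof.
move=> _ p_density [_ ae_w0 pw_loc] _ _ [E2_Lt compact_Lt].
move=> [E2e e_norm ae_eigen ae_e0] Ix px0 wx0 kw_L2 E2g ge0.
have [mp _ ae_p0] := p_density.
set kappa := fine _ in ae_eigen *.
(* One null set gathers all exceptional points, so that on [D] positivity and the eigenvalue
   equation hold everywhere. *)
have [N [mN N0 sub_N]] :=
  negligibleU (negligibleU ae_p0 ae_w0) (negligibleU ae_e0 ae_eigen).
set D := Iab a b `\` N.
have good y : D y -> [/\ 0 < p y, 0 < w y, 0 < e1 y & Lt a b p w e1 y = kappa * e1 y].
  move=> [Iy nNy]; split; apply: contrapT => bad; apply: nNy; apply: sub_N.
  - by left; left => /(_ Iy).
  - by left; right => /(_ Iy).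
  - by right; left => /(_ Iy).
  - by right; right => /(_ Iy).
pose m y := p y * w y.
have p0 y : D y -> 0 < p y by case/good.
have m0 y : D y -> 0 < m y by case/good => *; exact: mulr_gt0.
have mI : @measurable _ (measurableTypeR R) (Iab a b) by exact: measurable_Iab.
have mD : @measurable _ (measurableTypeR R) D by exact: measurableD.
have mm : @measurable_fun _ _ (measurableTypeR R) R (Iab a b) m.
  exact: L1loc_measurable.
have mmD := measurable_funS mI (@subDsetl _ _ N) mm.
have mE f : E2 a b p w f -> @measurable_fun _ _ (measurableTypeR R) R (Iab a b) f.
  by case=> -[].
have EL2 f : E2 a b p w f -> L2 lebesgue_measure D m f.
  by case=> + _ _; exact: L2w_L2.
have mK y : @measurable_fun _ _ (measurableTypeR R) R setT (Kker a b p y).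
  exact: (measurable_Kker_r mN N0 p_density p0).
have KvalE y f : E2 a b p w f ->
    Kval a b p y f = \int[lebesgue_measure]_(z in D) (Kker a b p y z * f z).
  move=> Ef; rewrite /Kval (intI_setD mN N0)//.
  by apply: measurable_funM; [exact: measurable_funTS|exact: mE].
have normE f : @measurable_fun _ _ (measurableTypeR R) R (Iab a b) f ->
    ip lebesgue_measure D m f f = normE2 a b p w f ^+ 2.
  move=> mf; have := ip_ge0 lebesgue_measure m0 f.
  by rewrite (ip_intI mN N0 mm)// /normE2 => /sqr_sqrtr ->.
have e0 y : D y -> 0 < e1 y by case/good.
have eD1 : ip lebesgue_measure D m e1 e1 = 1.
  by rewrite (normE _ (mE _ E2e)) e_norm expr1n.
have scaleD k f : E2 a b p w f -> E2 a b p w (fun y => k * f y).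
  exact: (E2Z mN N0 k mp p0 mm m0).
have K0 := Kker_gt0 mN N0 p_density p0.
have mKD : @measurable_fun _ _ (measurableTypeR R * measurableTypeR R)%type R
    (D `*` D) (fun z => Kker a b p z.1 z.2).
  exact: measurable_funTS (measurable_Kker mN N0 p_density p0).
have mKrD y : D y -> @measurable_fun _ _ (measurableTypeR R) R D (Kker a b p y).
  by move=> _; exact: measurable_funTS.
have k0_L2 : L2 lebesgue_measure D m (fun y => Kker a b p x y / m y).
  (* [kw] carries the constant factor $1/(p(x)w(x))$, removed by scaling; this uses that [p x] and
     [w x] are nonzero. *)
  have := L2Z mD mmD m0 (p x * w x) (L2w_L2 mN N0 mm m0 kw_L2).
  congr L2; apply/funext => y; rewrite /kw -/(m x).
  have -> : p x * p y * w x * w y = m x * m y by rewrite /m; ring.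
  have mx0 : m x != 0 by rewrite gt_eqF// mulr_gt0.
  by rewrite invfM mulrCA mulVKf.
have eigenD y : D y -> \int[lebesgue_measure]_(z in D) (Kker a b p y z * e1 z) =
    kappa * (e1 y * m y).
  move=> Dy; have my0 : m y != 0 by rewrite gt_eqF ?m0.
  have [_ _ _ eq_e] := good y Dy.
  by rewrite -(KvalE y e1 E2e) mulrA -eq_e /Lt -/(Kval a b p y e1) divfK.
have imageD f : E2 a b p w f ->
    kernel_image lebesgue_measure D m (Kker a b p) f (Lt a b p w f).
  move=> Ef y Dy; have my0 : m y != 0 by rewrite gt_eqF ?m0.
  by rewrite -(KvalE y f Ef) /Lt -/(Kval a b p y f) divfK.
have compactD u : (forall n, E2 a b p w (u n)) ->
    (exists M, forall n, ip lebesgue_measure D m (u n) (u n) <= M) ->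
    exists (phi : nat -> nat) (f : R -> R),
    [/\ {homo phi : k l / (k < l)%N >-> (k < l)%N}, E2 a b p w f &
      (fun n => ip lebesgue_measure D m (fun y => Lt a b p w (u (phi n)) y - f y)
        (fun y => Lt a b p w (u (phi n)) y - f y)) @ \oo --> (0 : R)].
  move=> Eu [M uM]; have [|phi [f [phi_incr Ef cf]]] := compact_Lt u Eu.
    exists (Num.sqrt M) => n.
    have nu0 : 0 <= normE2 a b p w (u n) by exact: sqrtr_ge0.
    rewrite -(ger0_norm nu0) -sqrtr_sqr -(normE _ (mE _ (Eu n))).
    exact: ler_wsqrtr (uM n).
  exists phi, f; split => //.
  (* Convergence is given for the norm and wanted for its square. *)
  rewrite (_ : (fun n => _) = (fun n => normE2 a b p w (Lt a b p w (u (phi n)) \- f) *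
      normE2 a b p w (Lt a b p w (u (phi n)) \- f))).
    by rewrite -[X in _ --> X](mulr0 0); exact: (cvgM cf cf).
  apply/funext => n; rewrite -expr2 normE; first by [].
  exact: (measurable_funB (mE _ (E2_Lt _ (Eu (phi n)))) (mE _ Ef)).
have ge_neq0 : ip lebesgue_measure D m g0 e1 != 0.
  have mg := mE g0 E2g; have me := mE e1 E2e.
  move: ge0; rewrite (ip_intI mN N0 mm mg me); apply: contra_neq => ge0.
  (* Integrability excludes an infinite value, which [fine] would also send to 0. *)
  have gei : lebesgue_measure.-integrable D (EFin \o (fun y => g0 y * e1 y * m y)).
    exact: (integrable_L2M mD mmD m0 (EL2 g0 E2g) (EL2 e1 E2e)).
  rewrite (_ : (fun y => _) = (fun y => g0 y * e1 y * m y)); last first.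
    by apply/funext => y; rewrite /m; ring.
  rewrite -[LHS]fineK ?ge0// (intI_setD mN N0); first exact: integrable_fin_num.
  by apply: measurable_funM => //; exact: measurable_funM.
have Eiter n : E2 a b p w (Lt_iter a b p w n g0).
  by elim: n => [//|n IHn]; exact: E2_Lt.
have := @power_iteration_ratio _ (measurableTypeR R) R lebesgue_measure D m e1
    (Kker a b p x) (Kker a b p) kappa
    (Pcdf a b p x * (1 - Pcdf a b p x))^-1 mD mmD m0 mKD mKrD.
move=> /(_ (fun y z Dy Dz => K0 y z Dy.1 Dz.1) (fun y z _ _ => KkerC _ _ _ _ _)).
move=> /(_ (fun y Dy => K0 x y Ix Dy.1) k0_L2).
move=> /(_ (fun y z _ _ => Kker_le mN N0 p_density p0 y z Ix) (EL2 e1 E2e)).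
move=> /(_ e0 eD1 eigenD _ _ imageD EL2 scaleD E2_Lt compactD g0 E2g ge_neq0) ratio.
rewrite (_ : (fun n => _) = (fun n =>
    (\int[lebesgue_measure]_(z in D) (Kker a b p x z * iter n.+1 (Lt a b p w) g0 z)) /
    (\int[lebesgue_measure]_(z in D) (Kker a b p x z * iter n (Lt a b p w) g0 z)))).
  exact: ratio.
by apply/funext => n; rewrite (KvalE x _ (Eiter n.+1)) (KvalE x _ (Eiter n)).
Qed.
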